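(* Let $W=\{\mathrm{id},s_1,s_2,s_1s_2,s_2s_1,s_1s_2s_1\}$ be the set of reduced words representing the six elements of the symmetric group $\mathscr{S}_3$, where $s_1=(1,2)$, $s_2=(2,3)$. For every $(\lambda,\mu)\in (S^1)^2$ and every $\omega\in W$, the representation $\psi_{(\lambda,\mu),\omega}$ of the $C^*$-algebra $A_2(0)$ is irreducible. Moreover, if $((\lambda,\mu),\omega)\neq((\lambda',\mu'),\omega')$, with $(\lambda,\mu),(\lambda',\mu')\in(S^1)^2$ and $\omega,\omega'\in W$, then the representations $\psi_{(\lambda,\mu),\omega}$ and $\psi_{(\lambda',\mu'),\omega'}$ are inequivalent.
   Context: **The $C^*$-algebra $A_2(0)$.** It is the universal unital $C^*$-algebra generated by $z_{i,j}$, $1\le i,j\le 3$, subject to the relations: $z_{i,j}z_{i,l}=0$ if $j<l$; $z_{i,j}z_{k,j}=0$ if $i<k$; $z_{i,l}z_{k,j}=z_{k,j}z_{i,l}$ if $i<k$, $j<l$; $z_{i,l}z_{k,j}=0$ if $i<k$, $j<l$, $\max\{i,j\}\ge\min\{k,l\}$; $z_{i,j}z_{k,l}=z_{k,l}z_{i,j}$ if $i<k$, $j<l$, $\max\{i,j\}+1<\min\{k,l\}$; $z_{i,j}z_{k,l}-z_{k,l}z_{i,j}=z_{i,l}z_{k,j}$ if $i<k$, $j<l$, $\max\{i,j\}+1=\min\{k,l\}$; $z_{1,1}z_{2,2}z_{3,3}=1$; $z_{1,1}^*=z_{2,2}z_{3,3}$, $z_{2,2}^*=z_{1,1}z_{3,3}$,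 $z_{3,3}^*=z_{1,1}z_{2,2}$, $z_{2,1}^*=z_{1,2}z_{3,3}$, $z_{3,2}^*=z_{1,1}z_{2,3}$, $z_{3,1}^*=z_{1,2}z_{2,3}$, $z_{1,2}^*=z_{2,1}z_{3,3}$, $z_{2,3}^*=z_{1,1}z_{3,2}$, $z_{1,3}^*=z_{2,1}z_{3,2}$; $z_{i,j}^*z_{r,s}=z_{r,s}z_{i,j}^*$ if $i\ne r$, $j\ne s$. **The representations $\psi_{(\lambda,\mu),\omega}$.** Let $\mathbb N=\{0,1,2,\dots\}$ and let $(e_m)_{m\ge0}$ be the standard basis of $\ell^2(\mathbb N)$; let $Se_m=e_{m-1}$ for $m\ge1$, $Se_0=0$, and $Ne_m=me_m$. For $q\in(0,1)$ and $k\in\{1,2\}$ put $$\psi_{s_k}^{(q)}(u_{i,j}(q))=\begin{cases}S\sqrt{I-q^{2N}}& i=j=k,\\ \sqrt{I-q^{2N}}\,S^*& i=j=k+1,\\ -q^{N+1}& i=k,\ j=k+1,\\ q^N& i=k+1,\ j=k,\\ \delta_{i,j}I&\text{otherwise}\end{cases}$$ (here $u_{i,j}(q)$, $1\le i,j\le3$, are the canonical generators of $A_2(q)=C(SU_q(3))$). For a word $\omega=s_{i_1}\cdots s_{i_k}$ set $$\psi_\omega^{(q)}(u_{i,j}(q))=\sum_{m_1,\dots,m_{k-1}=1}^{3}\psi_{s_{i_1}}^{(q)}(u_{i,m_1}(q))\otimes\psi_{s_{i_2}}^{(q)}(u_{m_1,m_2}(q))\otimes\cdots\otimes\psi_{s_{i_k}}^{(q)}(u_{m_{k-1},j}(q))$$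 on $\ell^2(\mathbb N)^{\otimes k}$, and $\psi_{\mathrm{id}}^{(q)}(u_{i,j}(q))=\delta_{i,j}$ on $\mathbb C$. For $(\lambda,\mu)\in(S^1)^2$ set $\psi_{(\lambda,\mu),\omega}^{(q)}(u_{i,j}(q))=c_i\,\psi_\omega^{(q)}(u_{i,j}(q))$ with $c_1=\lambda$, $c_2=\bar\lambda\mu$, $c_3=\bar\mu$. The norm limits $$\psi_{(\lambda,\mu),\omega}(z_{i,j})=\lim_{q\to0+}(-q)^{\min\{i-j,0\}}\,\psi^{(q)}_{(\lambda,\mu),\omega}(u_{i,j}(q))$$ exist and satisfy the defining relations of $A_2(0)$, and $\psi_{(\lambda,\mu),\omega}$ denotes the resulting representation of $A_2(0)$ on $\ell^2(\mathbb N)^{\otimes\ell(\omega)}$, where $\ell(\omega)$ is the length of $\omega$. *)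

(* Defs.v *)
(* The complex numbers are R[i], for an arbitrary R : realType. *)
From HB Require Import structures.
From mathcomp Require Import all_boot all_order all_algebra.
From mathcomp Require Import all_classical all_reals all_analysis.
From mathcomp Require Import complex ring.
From mathcomp.analysis.showcase Require summability.

Set Implicit Arguments.
Unset Strict Implicit.
Unset Printing Implicit Defensive.

Import Order.TTheory GRing.Theory Num.Theory.
Import numFieldNormedType.Exports.
Import ComplexField.Normc.

Local Open Scope classical_set_scope.
Local Open Scope complex_scope.
Local Open Scope ring_scope.

(* The norm is a plain function rather than an instance of normedModType: the
   hierarchy has no structure joining rings and norms below numDomainType. *)
HB.mixin Record Algebra_isCStar (R : realType) A of GRing.Algebra R[i] A := {
  star : A -> A ;
  starD : {morph star : a b / a + b} ;
  starZ : forall (c : R[i]) (a : A), star (c *: a) = c^* *: star a ;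
  starM : forall a b : A, star (a * b) = star b * star a ;
  starK : involutive star ;
  cnorm : A -> R ;
  ler_cnormD : forall a b : A, cnorm (a + b) <= cnorm a + cnorm b ;
  cnormZ : forall (c : R[i]) (a : A), cnorm (c *: a) = normc c * cnorm a ;
  cnorm_eq0 : forall a : A, cnorm a = 0 -> a = 0 ;
  ler_cnormM : forall a b : A, cnorm (a * b) <= cnorm a * cnorm b ;
  cnorm_star : forall a : A, cnorm (star a * a) = cnorm a ^+ 2 ;
  cnorm_complete : forall u : nat -> A,
    (forall e : R, 0 < e -> exists N : nat, forall m n : nat,
      (N <= m)%N -> (N <= n)%N -> cnorm (u m - u n) < e) ->
    exists a : A, (fun n => cnorm (u n - a)) @ \oo --> (0 : R)
}.

#[short(type="cstarType")]
HB.structure Definition CStar (R : realType) :=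
  {A of Algebra_isCStar R A & GRing.Algebra R[i] A}.

Section ell2_space.
Context {R : realType} {I : choiceType}.
Local Notation C := R[i].
Implicit Types x y : I -> C.

Definition l2sq x : \bar R := \esum_(i in [set: I]) (normc (x i) ^+ 2)%:E.

(* +oo when x is not square summable. *)
Definition l2norm x : \bar R := sqrte (l2sq x).

Definition ell2_pred : {pred I -> C} := fun x => `[< (l2sq x < +oo)%E >].

Lemma normc_ge0 (c : C) : 0 <= normc c.
Proof. by case: c => a b; exact: sqrtr_ge0. Qed.

Lemma l2sq_ge0 x : (0 <= l2sq x)%E.
Proof. by apply: esum_ge0 => i _; rewrite lee_fin exprn_ge0// normc_ge0. Qed.

Lemma le_esumZ (k : R) (a : I -> R) : 0 <= k -> (forall i, 0 <= a i) ->
  (\esum_(i in [set: I]) (k * a i)%:E%R <= k%:E * \esum_(i in [set: I]) (a i)%:E)%E.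
Proof.
move=> k0 a0; apply: ge_ereal_sup => _ [X [finX _] <-].
under eq_fsbigr do rewrite EFinM.
rewrite -ge0_mule_fsumr; last by move=> i; rewrite lee_fin.
by apply: lee_wpmul2l; rewrite ?lee_fin//; apply: esum_ge; exists X.
Qed.

Lemma l2sqD (s t : R) x y : 0 < s -> 0 < t ->
  (l2sq (x + y)%R
    <= (1 + t / s)%:E%R * l2sq x + (1 + s / t)%:E%R * l2sq y)%E.
Proof.
move=> s0 t0; have st : 0 <= t / s by rewrite divr_ge0// ltW.
have ts : 0 <= s / t by rewrite divr_ge0// ltW.
have h k (z : I -> C) : 0 <= k ->
    (\esum_(i in [set: I]) (k * normc (z i) ^+ 2)%:E%R <= k%:E * l2sq z)%E.
  by move=> k0; apply: le_esumZ => // i; rewrite exprn_ge0// normc_ge0.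
apply: le_trans; last by apply: leeD; apply: h; rewrite addr_ge0.
rewrite -esumD; try by move=> i _; rewrite lee_fin mulr_ge0// ?addr_ge0//
  exprn_ge0// normc_ge0.
apply: le_esum => i _; rewrite -EFinD lee_fin.
have := le_normcD (x i) (y i); have := normc_ge0 (x i + y i).
rewrite [(x + y) i]/(x i + y i).
move: (normc _) (normc (x i)) (normc (y i)) => n a b n0 nab.
apply: (@le_trans _ _ ((a + b) ^+ 2)).
  by rewrite ler_sqr ?nnegrE// (le_trans n0).
rewrite -subr_ge0.
have -> : (1 + t / s) * a ^+ 2 + (1 + s / t) * b ^+ 2 - (a + b) ^+ 2
    = (t * a - s * b) ^+ 2 / (s * t) by field; rewrite !gt_eqF.
by rewrite divr_ge0 ?sqr_ge0// mulr_ge0// ltW.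
Qed.

Lemma l2sqZ (c : C) x : l2sq (c *: x) = ((normc c ^+ 2)%:E%R * l2sq x)%E.
Proof.
have h (d : C) z : (l2sq (d *: z)%R <= (normc d ^+ 2)%:E%R * l2sq z)%E.
  apply: le_trans (le_esumZ _ _).
  - apply: le_esum => i _; rewrite lee_fin [(d *: z) i]/(d * z i).
    by rewrite normcM exprMn.
  - by rewrite exprn_ge0// normc_ge0.
  - by move=> i; rewrite exprn_ge0// normc_ge0.
apply/eqP; rewrite eq_le h/=; have [->|c0] := eqVneq c 0.
  by rewrite normc0 expr0n mul0e l2sq_ge0.
have nc0 : normc c != 0 by apply: contra_neq c0; exact: eq0_normc.
have := h c^-1 (c *: x); rewrite scalerA mulVf// scale1r normcV exprVn => hx.
apply: le_trans (lee_wpmul2l _ hx) _; first by rewrite lee_fin sqr_ge0.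
by rewrite muleA -EFinM mulfV ?mul1e// expf_neq0.
Qed.

Lemma ell2_submod_closed : submod_closed ell2_pred.
Proof.
split=> [|c x y /asboolP hx /asboolP hy]; apply/asboolP.
  have -> : l2sq 0 = 0%E by apply: esum1 => i _; rewrite normc0 expr0n.
  exact: ltry.
apply: le_lt_trans (l2sqD _ _ ltr01 ltr01) _.
have fin z : (l2sq z < +oo)%E -> l2sq z \is a fin_num.
  by move=> hz; rewrite ge0_fin_numE// l2sq_ge0.
rewrite l2sqZ -(fineK (fin _ hx)) -(fineK (fin _ hy)) -!EFinM -EFinD.
exact: ltry.
Qed.

HB.instance Definition _ :=
  GRing.isSubmodClosed.Build C (I -> C) ell2_pred ell2_submod_closed.

End ell2_space.

Section ell2.
Variables (R : realType) (I : choiceType).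
Local Notation C := R[i].

Record ell2 := Ell2 { ell2_fun :> I -> C ; _ : ell2_fun \in ell2_pred }.

HB.instance Definition _ := [isSub for ell2_fun].
HB.instance Definition _ := [Choice of ell2 by <:].
HB.instance Definition _ := [SubChoice_isSubLmodule of ell2 by <:].

Definition ell2_norm (x : ell2) : R := fine (l2norm x).

Lemma l2sq_ell2 (x : ell2) : l2sq x = (ell2_norm x ^+ 2)%:E.
Proof.
have /asboolP hx : (x : I -> C) \in ell2_pred by case: x.
have := l2sq_ge0 x; rewrite /ell2_norm /l2norm.
case: (l2sq x) hx => [r| |]//= _; rewrite lee_fin => r0.
by rewrite sqr_sqrtr.
Qed.

Lemma ell2_norm_ge0 x : 0 <= ell2_norm x.
Proof. exact/fine_ge0/sqrte_ge0. Qed.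

Lemma ell2_normD x y : ell2_norm (x + y) <= ell2_norm x + ell2_norm y.
Proof.
apply/ler_addgt0Pr => e e0.
set s := ell2_norm x + e / 2; set t := ell2_norm y + e / 2.
have e20 : 0 < e / 2 by rewrite divr_gt0.
have s0 : 0 < s by rewrite ltr_wpDl// ell2_norm_ge0.
have t0 : 0 < t by rewrite ltr_wpDl// ell2_norm_ge0.
have -> : ell2_norm x + ell2_norm y + e = s + t by rewrite /s/t; field.
have := l2sqD x y s0 t0.
rewrite -[((x : I -> C) + y)%R]/((x + y : ell2) : I -> C).
rewrite !l2sq_ell2 -!EFinM -EFinD lee_fin => h.
rewrite -ler_sqr ?nnegrE ?ell2_norm_ge0//; last by rewrite addr_ge0// ltW.
apply: (le_trans h).
have -> : (s + t) ^+ 2 = (1 + t / s) * s ^+ 2 + (1 + s / t) * t ^+ 2.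
  by field; rewrite !gt_eqF.
apply: lerD; apply: ler_wpM2l; rewrite ?addr_ge0 ?divr_ge0 ?(ltW s0) ?(ltW t0)//.
  by rewrite ler_sqr ?nnegrE ?ell2_norm_ge0 ?(ltW s0)// lerDl ltW.
by rewrite ler_sqr ?nnegrE ?ell2_norm_ge0 ?(ltW t0)// lerDl ltW.
Qed.

Lemma ell2_normZ (c : C) x : ell2_norm (c *: x) = normc c * ell2_norm x.
Proof.
apply/eqP; rewrite -(@eqrXn2 _ 2)//; first last.
- by rewrite mulr_ge0 ?normc_ge0 ?ell2_norm_ge0.
- exact: ell2_norm_ge0.
have := l2sq_ell2 (c *: x).
rewrite -[((c *: x : ell2) : I -> C)]/(c *: (x : I -> C)) l2sqZ l2sq_ell2 -EFinM.
by move=> [<-]; rewrite exprMn.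
Qed.

Lemma ell2_norm_eq0 x : ell2_norm x = 0 -> x = 0.
Proof.
move=> x0; apply: val_inj; apply/funext => i; apply: eq0_normc.
have : ((normc (x i) ^+ 2)%:E <= l2sq x)%E.
  by apply: esum_ge; exists [set i]; [split|rewrite fsbig_set1].
rewrite l2sq_ell2 x0 expr0n lee_fin => /= xi0; apply/eqP.
by rewrite -sqrf_eq0 eq_le xi0 exprn_ge0// normc_ge0.
Qed.

Let normC (x : ell2) : C := (ell2_norm x)%:C.

Let normC_D x y : normC (x + y) <= normC x + normC y.
Proof. by rewrite /normC -rmorphD lecR ell2_normD. Qed.

Let normC_Z (c : C) x : normC (c *: x) = `|c| * normC x.
Proof. by rewrite /normC ell2_normZ rmorphM. Qed.

Let normC_eq0 x : normC x = 0 -> x = 0.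
Proof. by move=> /complexI; exact: ell2_norm_eq0. Qed.

HB.instance Definition _ :=
  @Lmodule_isNormed.Build C ell2 normC normC_D normC_Z normC_eq0.

End ell2.

(* Sums over I are limits along the finite subsets of I. The inner product is
   linear in x. *)
Definition ell2_dot (R : realType) (I : choiceType) (x y : ell2 R I) : R[i] :=
  summability.sum (fun i => (x i * (y i)^* : R[i]^o)).

Section representations.
Variables (R : realType) (A : cstarType R).

(* Unital *-representations of A by bounded operators on l^2(I). *)
Record is_rep (I : choiceType) (pi : A -> ell2 R I -> ell2 R I) : Prop := {
  rep_linear : forall a, linear (pi a) ;
  rep_continuous : forall a, continuous (pi a) ;
  rep_linearl : forall x, linear (pi ^~ x) ;
  rep1 : forall x, pi 1 x = x ;
  repM : forall a b x, pi (a * b) x = pi a (pi b x) ;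
  rep_star : forall a x y, ell2_dot (pi (star a) x) y = ell2_dot x (pi a y)
}.

Definition irreducible_rep (I : choiceType) (pi : A -> ell2 R I -> ell2 R I) :=
  [set: ell2 R I] <> [set 0] /\
  forall M : set (ell2 R I),
    closed M -> M 0 -> (forall (c : R[i]) x y, M x -> M y -> M (c *: x + y)) ->
    (forall a x, M x -> M (pi a x)) ->
    M = [set 0] \/ M = [set: ell2 R I].

Definition equivalent_reps (I J : choiceType)
    (pi : A -> ell2 R I -> ell2 R I) (rho : A -> ell2 R J -> ell2 R J) :=
  exists U : ell2 R I -> ell2 R J,
    [/\ linear U, bijective U,
        forall x y, ell2_dot (U x) (U y) = ell2_dot x y &
        forall a x, U (pi a x) = rho a (U x)].

End representations.

(* Indices 1, 2, 3 are represented by the elements 0, 1, 2 of 'I_3; all index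
   conditions below are invariant under this shift. *)
Definition i1 : 'I_3 := @Ordinal 3 0 isT.
Definition i2 : 'I_3 := @Ordinal 3 1 isT.
Definition i3 : 'I_3 := @Ordinal 3 2 isT.

Section A20.
Variable R : realType.

Record A20_relations (A : cstarType R) (z : 'I_3 -> 'I_3 -> A) : Prop := {
  A20_row : forall i j l : 'I_3, (j < l)%N -> z i j * z i l = 0 ;
  A20_col : forall i j k : 'I_3, (i < k)%N -> z i j * z k j = 0 ;
  A20_anti : forall i j k l : 'I_3, (i < k)%N -> (j < l)%N ->
    z i l * z k j = z k j * z i l ;
  A20_anti0 : forall i j k l : 'I_3, (i < k)%N -> (j < l)%N ->
    (maxn i j >= minn k l)%N -> z i l * z k j = 0 ;
  A20_diag : forall i j k l : 'I_3, (i < k)%N -> (j < l)%N ->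
    ((maxn i j).+1 < minn k l)%N -> z i j * z k l = z k l * z i j ;
  A20_diag1 : forall i j k l : 'I_3, (i < k)%N -> (j < l)%N ->
    (maxn i j).+1 = minn k l -> z i j * z k l - z k l * z i j = z i l * z k j ;
  A20_det : z i1 i1 * z i2 i2 * z i3 i3 = 1 ;
  A20_star11 : star (z i1 i1) = z i2 i2 * z i3 i3 ;
  A20_star22 : star (z i2 i2) = z i1 i1 * z i3 i3 ;
  A20_star33 : star (z i3 i3) = z i1 i1 * z i2 i2 ;
  A20_star21 : star (z i2 i1) = z i1 i2 * z i3 i3 ;
  A20_star32 : star (z i3 i2) = z i1 i1 * z i2 i3 ;
  A20_star31 : star (z i3 i1) = z i1 i2 * z i2 i3 ;
  A20_star12 : star (z i1 i2) = z i2 i1 * z i3 i3 ;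
  A20_star23 : star (z i2 i3) = z i1 i1 * z i3 i2 ;
  A20_star13 : star (z i1 i3) = z i2 i1 * z i3 i2 ;
  A20_starC : forall i j r s : 'I_3, i != r -> j != s ->
    star (z i j) * z r s = z r s * star (z i j)
}.

(* A, with the generators z, is the universal unital C*-algebra A_2(0). *)
Definition is_A20 (A : cstarType R) (z : 'I_3 -> 'I_3 -> A) : Prop :=
  A20_relations z /\
  forall (B : cstarType R) (w : 'I_3 -> 'I_3 -> B), A20_relations w ->
    exists f : {lrmorphism A -> B},
      [/\ forall a, f (star a) = star (f a), forall i j, f (z i j) = w i j &
          forall g : {lrmorphism A -> B}, (forall a, g (star a) = star (g a)) ->
            (forall i j, g (z i j) = w i j) -> g =1 f].

End A20.

Section psi.
Variable R : realType.
Local Notation C := R[i].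

(* The operators of the family at q > 0 are defined by their formulas on all
   functions I -> C; the bounded operator on l^2(I) is the restriction. *)
Definition opS (x : nat -> C) : nat -> C := fun n => x n.+1.
Definition opSadj (x : nat -> C) : nat -> C :=
  fun n => if n is n'.+1 then x n' else 0.

(* f(N), where N e_m = m e_m. *)
Definition opN (f : nat -> R) (x : nat -> C) : nat -> C :=
  fun n => (f n)%:C * x n.

(* The letter s_k is encoded by k - 1 : 'I_2, so that it matches the shifted
   matrix indices. *)
Definition psi_letter (q : R) (k : 'I_2) (i j : 'I_3) :
    (nat -> C) -> (nat -> C) :=
  if (i == k :> nat) && (j == k :> nat) then
    opS \o opN (fun n => Num.sqrt (1 - q ^+ (2 * n)))
  else if (i == k.+1 :> nat) && (j == k.+1 :> nat) then
    opN (fun n => Num.sqrt (1 - q ^+ (2 * n))) \o opSadj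
  else if (i == k :> nat) && (j == k.+1 :> nat) then
    opN (fun n => - q ^+ n.+1)
  else if (i == k.+1 :> nat) && (j == k :> nat) then
    opN (fun n => q ^+ n)
  else fun x => if i == j then x else 0.

(* l^2(N)^(tensor k) is l^2(N^k), e_{m_1} (x) ... (x) e_{m_k} being the basis
   vector at (m_1, ..., m_k). *)
Definition multi (k : nat) : choiceType := {ffun 'I_k -> nat}.

Definition upd k (m : multi k) (t : 'I_k) (n : nat) : multi k :=
  [ffun u => if u == t then n else m u].

(* 1 (x) ... (x) T (x) ... (x) 1, with T in position t. *)
Definition leg k (t : 'I_k) (T : (nat -> C) -> (nat -> C)) (x : multi k -> C) :
    multi k -> C :=
  fun m => T (fun n => x (upd m t n)) (m t).

(* T_1 (x) ... (x) T_k, as the product of its legs. *)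
Definition tensor k (T : 'I_k -> (nat -> C) -> (nat -> C)) :
    (multi k -> C) -> (multi k -> C) :=
  foldr (fun t f => leg t (T t) \o f) id (enum 'I_k).

(* The sum is over the paths i = m_0, m_1, ..., m_k = j; for the empty word it
   is delta_{i,j}. *)
Definition psi_word (q : R) (w : seq 'I_2) (i j : 'I_3)
    (x : multi (size w) -> C) : multi (size w) -> C :=
  \sum_(m : {ffun 'I_(size w).+1 -> 'I_3} | (m ord0 == i) && (m ord_max == j))
    tensor (fun t => psi_letter q (tnth (in_tuple w) t)
                       (m (widen_ord (leqnSn _) t)) (m (lift ord0 t))) x.

Arguments psi_word : clear implicits.

Definition psi_coef (lam mu : C) (i : 'I_3) : C :=
  nth 0 [:: lam; lam^* * mu; mu^*] i.

Definition psi_q (q : R) (lam mu : C) (w : seq 'I_2) (i j : 'I_3)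
    (x : multi (size w) -> C) : multi (size w) -> C :=
  psi_coef lam mu i *: psi_word q w i j x.

Arguments psi_q : clear implicits.

(* Operator norm of a linear map from l^2(I) into all functions on I; it is
   +oo unless T is a bounded operator on l^2(I). *)
Definition opnorm (I : choiceType) (T : ell2 R I -> (I -> C)) : \bar R :=
  ereal_sup [set l2norm (T x) | x in [set x : ell2 R I | `|x| <= 1]].

(* pi is the representation psi_{(lam,mu),w} of A_2(0) = (A, z). *)
Definition is_psi (A : cstarType R) (z : 'I_3 -> 'I_3 -> A) (lam mu : C)
    (w : seq 'I_2)
    (pi : A -> ell2 R (multi (size w)) -> ell2 R (multi (size w))) : Prop :=
  is_rep pi /\
  forall i j : 'I_3,
    opnorm (fun x => (- q)%:C ^ Num.min (i%:Z - j%:Z) 0 *: psi_q q lam mu w i j x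
                       - (pi (z i j) x : multi (size w) -> C))
      @[q --> (0 : R)^'+] --> 0%E.

Arguments is_psi {A} z lam mu w pi.

Definition s1 : 'I_2 := @Ordinal 2 0 isT.
Definition s2 : 'I_2 := @Ordinal 2 1 isT.
Definition W : seq (seq 'I_2) :=
  [:: [::]; [:: s1]; [:: s2]; [:: s1; s2]; [:: s2; s1]; [:: s1; s2; s1]].

End psi.

Arguments is_psi {R A} z lam mu w pi.

(* Main.v *)
Require Import Defs.
From mathcomp Require Import all_boot all_order all_algebra.
From mathcomp Require Import all_classical all_reals all_analysis.
From mathcomp Require Import complex zify.

(** Write S for the unilateral shift, P for the projection onto e_0. Multiplying
    u_(i,j) by the prescribed power of -q and letting q tend to 0 leaves, in the
    sum over paths defining the word representation, exactly the monotone paths,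
    and turns every letter into one of the operators 0, 1, S, S^*, P. Each of
    these is composition with a partial injection of the basis indices, so every
    z_(i,j) becomes c_i times a short sum of tensor products of partial
    injections, and this sum can be computed ([terms], [psi_terms]). Pointwise
    convergence is all that is extracted from convergence in operator norm.

    Irreducibility. Call two basis vectors e_m, e_m' linked when some element of
    the algebra acts like a nonzero multiple of the matrix unit E_(m,m') as seen
    from row m and from column m'. Linking is reflexive and transitive, and the
    generators supply enough links to travel from the vacuum e_0 to every e_m
    and back ([psi_connected]). Moreover the rank one projection onto e_0 is,
    up to a scalar, a product z_(1,a) z_(3,b). A nonzero vector of an invariant
    subspace has a nonzero coordinate; carrying it to the vacuum coordinate and
    projecting puts e_0, hence every e_m, into the subspace, which is everything
    if it is closed ([irreducible_of_linked]).

    Inequivalence. The columns a and b above are those of the last nonzero entry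
    of the first row and of the first nonzero entry of the third row, and the
    pair (a, b) determines the word (it is a piece of the permutation). At these
    places z_(1,a) is lam times a nonzero idempotent and z_(3,b) is mu^* times
    one. The eigenvalues of z_(i,j) are invariant under equivalence, so they
    recover first the word and then lam and mu. *)

Import Order.TTheory GRing.Theory Num.Theory.
Import numFieldNormedType.Exports.
Import ComplexField.Normc.
Local Open Scope classical_set_scope.
Local Open Scope complex_scope.
Local Open Scope ring_scope.

Set Implicit Arguments.
Unset Strict Implicit.
Unset Printing Implicit Defensive.

(** * Square-summable families and bounded operators *)

Lemma linear_prop0 (K : pzRingType) (U V : lmodType K) (f : U -> V) : linear f -> f 0 = 0.
Proof.
by move=> /(_ 1 0 0) h; rewrite !scale1r addr0 in h; apply/(addrI (f 0)); rewrite -h addr0.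
Qed.

Lemma linear_propZ (K : pzRingType) (U V : lmodType K) (f : U -> V) : linear f ->
  forall c x, f (c *: x) = c *: f x.
Proof. by move=> h c x; have := h c x 0; rewrite !addr0 (linear_prop0 h) addr0. Qed.

Section norms.
Variable R : realType.
Local Notation C := R[i].

Lemma normc_le_l2norm (I : choiceType) (y : I -> C) (m : I) :
  ((normc (y m))%:E <= l2norm y)%E.
Proof.
have h : ((normc (y m) ^+ 2)%:E <= l2sq y)%E.
  by apply: esum_ge; exists [set m]; [split|rewrite fsbig_set1].
rewrite -(@lee_sqrt _ _ _ (l2sq_ge0 y)) in h; apply: le_trans h.
by rewrite /= sqrtr_sqr ger0_norm// normc_ge0.
Qed.

Lemma normc_le_opnorm (I : choiceType) (T : ell2 R I -> (I -> C)) (x : ell2 R I) (m : I) :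
  `|x| <= 1 -> ((normc (T x m))%:E <= opnorm T)%E.
Proof.
move=> x1; apply: le_trans (normc_le_l2norm _ m) _.
by apply: ereal_sup_ubound; exists x.
Qed.

Lemma le_normc_sum (I : Type) (r : seq I) (P : pred I) (F : I -> C) :
  normc (\sum_(i <- r | P i) F i) <= \sum_(i <- r | P i) normc (F i).
Proof.
apply: (big_ind2 (fun z t => normc z <= t)) => [|z1 t1 z2 t2 h1 h2|//].
  by rewrite normc0.
exact: le_trans (le_normcD _ _) (lerD h1 h2).
Qed.

Lemma normc_real (a : R) : normc a%:C = `|a|.
Proof. by rewrite /= expr0n addr0 sqrtr_sqr. Qed.

End norms.

Section ell2_basis.
Variables (R : realType) (I : choiceType).
Local Notation C := R[i].

Lemma evec_subproof (m : I) : (fun n => (n == m)%:R : C) \in ell2_pred.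
Proof.
apply/asboolP; rewrite /l2sq (esumID [set m]); last first.
  by move=> n _; rewrite lee_fin exprn_ge0// normc_ge0.
rewrite setTI esum_set1 ?lee_fin ?exprn_ge0 ?normc_ge0// esum1 ?adde0 ?ltry//.
move=> n [_ /eqP/negPf nm]; by rewrite nm normc0 expr0n.
Qed.

Definition evec (m : I) : ell2 R I := Ell2 (evec_subproof m).

Lemma evecE m n : evec m n = (n == m)%:R.
Proof. by []. Qed.

Lemma evec_neq0 (m : I) : evec m != 0.
Proof.
apply/eqP => /(congr1 (fun x : ell2 R I => x m)) /eqP.
by rewrite evecE eqxx oner_eq0.
Qed.

Lemma ell2P (x y : ell2 R I) : (forall m, x m = y m) -> x = y.
Proof. by move=> xy; apply: val_inj; apply/funext. Qed.

(** Finite sections approximate: the error is the part of the convergent sum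
    of squares that a good finite index set misses. *)
Lemma ell2_tail (x : ell2 R I) (e : R) : 0 < e ->
  exists s : seq I, forall y : ell2 R I,
    (forall i, y i = if i \in s then x i else 0) -> ell2_norm (x - y) < e.
Proof.
move=> e0.
have sqge (z : ell2 R I) i : (0 <= (normc (z i) ^+ 2)%:E)%E.
  by rewrite lee_fin exprn_ge0// normc_ge0.
have fx : l2sq x \is a fin_num by rewrite l2sq_ell2.
have [_ [X [finX _] <-] hX] := ub_ereal_sup_adherent (exprn_gt0 2 e0) fx.
have /finite_seqP[s Xs] := finX; exists s => y yE.
have dE i : (x - y) i = x i - y i by [].
move: (x - y) dE => d dE.
have e2 : ((ell2_norm d ^+ 2)%:E < (e ^+ 2)%:E)%E.
  rewrite -l2sq_ell2 /l2sq (esumID X)// setTI esum1 ?add0e; last first.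
    move=> i; rewrite Xs => /= i_s.
    by rewrite dE yE i_s subrr normc0 expr0n.
  have -> : \esum_(i in [set: I] `&` ~` X) (normc (d i) ^+ 2)%:E =
            \esum_(i in [set: I] `&` ~` X) (normc (x i) ^+ 2)%:E.
    apply: eq_esum => i [_]; rewrite Xs => /negP/negPf i_s.
    by rewrite dE yE i_s subr0.
  move: hX; rewrite -[ereal_sup _]/(l2sq x) {1}/l2sq (esumID X)// setTI (esum_fset finX)//.
  rewrite lteBlDr// lteD2lE//.
  by rewrite fsumEFin.
by move: e2; rewrite lte_fin ltr_sqr// nnegrE ?ell2_norm_ge0// ltW.
Qed.

Lemma closed_evec (M : set (ell2 R I)) : closed M -> M 0 ->
  (forall (c : C) x y, M x -> M y -> M (c *: x + y)) ->
  (forall m, M (evec m)) -> M = [set: ell2 R I].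
Proof.
move=> Mc M0 Ml Mb; apply/seteqP; split => // x _.
apply: contrapT => nMx.
have : nbhs x (~` M) by apply: open_nbhs_nbhs; split => //; exact: closed_openC.
move/nbhs_normP => [[e e'] /=]; rewrite ltcE/= => /andP[/eqP -> e0] hb.
have [s hs] := ell2_tail x e0.
have [y My yE] : exists2 y, M y & forall i, y i = if i \in s then x i else 0.
  elim: (s) => [|a s' [y My yE]]; first by exists 0.
  exists ((x a - y a) *: evec a + y) => [|i]; first exact: Ml.
  transitivity ((x a - y a) * (i == a)%:R + y i); first by [].
  rewrite inE.
  by case: eqVneq => [->|_]; rewrite ?mulr1 ?subrK// mulr0 add0r yE.
apply: (hb y) => //=.
by rewrite -[`|x - y|]/((ell2_norm (x - y))%:C) ltcE /= eqxx /= hs.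
Qed.

End ell2_basis.

(** * The letters near q = 0 *)

(** The operators 0, 1, S, S^* and P that the letters become at q = 0. Each
    sends x to the function equal to x (op_img n) at the points n of op_dom and
    to 0 elsewhere. For q > 0 a letter reads x at the same point op_img n, also
    for n outside op_dom, where its coefficient need not vanish yet; so op_img
    is total. *)
Inductive elem_op := Zero | One | Shift | Coshift | Vac.

Definition op_img (o : elem_op) (n : nat) : nat :=
  match o with Shift => n.+1 | Coshift => n.-1 | _ => n end.

Definition op_dom (o : elem_op) (n : nat) : bool :=
  match o with Zero => false | Coshift => (0 < n)%N | Vac => n == 0%N | _ => true end.

Lemma op_img_inj o n n' : op_dom o n -> op_dom o n' -> op_img o n = op_img o n' -> n = n'.
Proof. by case: o n n' => [] [|n] [|n'] //= _ _ [->]. Qed.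

Definition limit_letter (k a b : nat) : elem_op :=
  if (a == k) && (b == k) then Shift
  else if (a == k.+1) && (b == k.+1) then Coshift
  else if (a == k) && (b == k.+1) || (a == k.+1) && (b == k) then Vac
  else if a == b then One else Zero.

Section weights.
Variable R : realType.

(** The weight of a letter once its power of -q has been taken out; what
    remains is continuous at q = 0, where it is the indicator of op_dom. *)
Definition weight (q : R) (o : elem_op) (n : nat) : R :=
  match o with
  | Zero => 0
  | One => 1
  | Shift => Num.sqrt (1 - q ^+ (2 * n.+1))
  | Coshift => Num.sqrt (1 - q ^+ (2 * n))
  | Vac => q ^+ n
  end.

Lemma weight0 o n : weight 0 o n = (op_dom o n)%:R.
Proof.
case: o => //=; rewrite ?expr0n ?mulnS ?addSn //= ?subr0 ?sqrtr1 //.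
by case: n => [|n]; rewrite ?subrr ?sqrtr0// subr0 sqrtr1.
Qed.

Lemma weight_cvg o n : weight q o n @[q --> (0 : R)] --> weight 0 o n.
Proof.
have pw (e : nat) : q ^+ e @[q --> (0 : R)] --> (0 : R) ^+ e.
  exact: (@exprn_continuous _ e).
have sq (e : nat) : Num.sqrt (1 - q ^+ e) @[q --> (0 : R)] --> Num.sqrt (1 - 0 ^+ e).
  apply: (@cvg_comp _ _ _ (fun q : R => 1 - q ^+ e) Num.sqrt _ (nbhs ((1 : R) - 0 ^+ e))).
    by apply: cvgB; [exact: cvg_cst|exact: pw].
  exact: sqrt_continuous.
by case: o => //=; do ?[exact: cvg_cst|exact: sq|exact: pw].
Qed.

(** Only the entry (k, k+1), which is -q^(N+1), has a factor -q in common: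
    climbing by one costs one power of -q, going down costs nothing. *)
Lemma psi_letterE (q : R) (k : 'I_2) (i j : 'I_3) (x : nat -> R[i]) n :
  psi_letter q k i j x n =
  ((- q) ^+ (j - i) * weight q (limit_letter k i j) n)%:C
    * x (op_img (limit_letter k i j) n).
Proof.
rewrite /psi_letter /limit_letter.
case: ifP => [/andP[/eqP-> /eqP->]|_]; first by rewrite subnn mul1r.
case: ifP => [/andP[/eqP-> /eqP->]|_].
  rewrite subnn mul1r /= /opN /opSadj; case: n => [|n]//=.
  by rewrite muln0 expr0 subrr sqrtr0 !mul0r.
case: ifP => [/andP[/eqP-> /eqP->]|_].
  by rewrite subSnn expr1 /= /opN exprS mulNr.
case: ifP => [/andP[/eqP-> /eqP->]|_].
  by rewrite (eqP (leqnSn k)) mul1r.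
rewrite -val_eqE/=; case: ifP => [/eqP->|_] /=.
  by rewrite subnn !mul1r.
by rewrite mulr0 mul0r.
Qed.

Lemma tensorE k (T : 'I_k -> (nat -> R[i]) -> nat -> R[i])
    (g : 'I_k -> nat -> R) (f : 'I_k -> nat -> nat) :
  (forall t x n, T t x n = (g t n)%:C * x (f t n)) ->
  forall x m, tensor T x m
    = (\prod_t g t (m t))%:C * x [ffun t => f t (m t)].
Proof.
move=> TE x m; rewrite /tensor.
have : forall (s : seq 'I_k) (m : multi k), uniq s ->
    foldr (fun t F => leg t (T t) \o F) id s x m =
    (\prod_(t <- s) g t (m t))%:C *
      x [ffun t => if t \in s then f t (m t) else m t].
  elim=> [|t s IH] {}m /=.
    rewrite big_nil mul1r => _; congr (x _).
    by apply/ffunP => u; rewrite ffunE.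
  case/andP=> ts us; rewrite /leg TE IH // big_cons rmorphM mulrA; congr (_ * x _).
    congr (_ * (_)%:C); apply: eq_big_seq => u us'.
    by rewrite ffunE; case: eqP ts => // <-; rewrite us'.
  apply/ffunP => u; rewrite !ffunE inE.
  case: (eqVneq u t) => [->|_] //=; by rewrite (negPf ts).
move=> ->; last exact: enum_uniq.
rewrite -big_enum; congr (_ * x _).
by apply/ffunP => u; rewrite !ffunE mem_enum.
Qed.

End weights.

(** * Paths and the limiting matrix coefficients *)

Definition path_ops (w s : seq nat) : seq elem_op :=
  [seq limit_letter (nth 0%N w t) (nth 0%N s t) (nth 0%N s t.+1) | t <- iota 0 (size w)].

(** Total climb of a path: the exponent of -q that it contributes. *)
Definition ascent (s : seq nat) (n : nat) : nat :=
  sumn [seq (nth 0 s t.+1 - nth 0 s t)%N | t <- iota 0 n].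

Fixpoint vertex_seqs (n : nat) : seq (seq nat) :=
  if n is n'.+1 then [seq a :: s | a <- iota 0 3, s <- vertex_seqs n'] else [:: [::]].

Definition nonzero_op (o : elem_op) : bool := if o is Zero then false else true.

(** The tensor products that survive in the (i, j) coefficient: a path survives
    when it climbs no more than needed (it is then monotone) and all its letters
    are nonzero. Plain lists of numbers are used so that this table evaluates. *)
Definition terms (w : seq nat) (i j : nat) : seq (seq elem_op) :=
  [seq path_ops w s | s <- vertex_seqs (size w).+1 &
    [&& nth 0%N s 0 == i, nth 0%N s (size w) == j,
        ascent s (size w) == (j - i)%N & all nonzero_op (path_ops w s)]].

Definition tensor_dom k (l : seq elem_op) (m : multi k) : bool :=
  [forall t : 'I_k, op_dom (nth One l t) (m t)].

Definition tensor_img k (l : seq elem_op) (m : multi k) : multi k :=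
  [ffun t : 'I_k => op_img (nth One l t) (m t)].

Lemma mem_vertex_seqs n s : (s \in vertex_seqs n) = (size s == n) && all (ltn^~ 3) s.
Proof.
elim: n s => [|n IH] s; first by case: s.
rewrite -[vertex_seqs n.+1]/[seq a :: s' | a <- iota 0 3, s' <- vertex_seqs n].
apply/allpairsP/idP => [[[b s'] [/= b3 s'n ->]]|].
  by move: b3 s'n; rewrite IH /= eqSS !inE => /or3P[] /eqP-> /andP[-> ->].
case: s => // a s /and3P[sn a3 s3]; exists (a, s); split => //=.
  by rewrite !inE; case: (a) a3 => [|[|[|?]]].
by rewrite IH -eqSS sn.
Qed.

Lemma vertex_seqs_uniq n : uniq (vertex_seqs n).
Proof.
elim: n => // n IH; apply: allpairs_uniq => //.
by move=> [a s] [b s'] /= _ _ [-> ->].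
Qed.

Definition path_seq n (p : {ffun 'I_n -> 'I_3}) : seq nat :=
  [seq nat_of_ord (p t) | t <- enum 'I_n].

Lemma nth_path_seq n (p : {ffun 'I_n -> 'I_3}) (t : 'I_n) :
  nth 0%N (path_seq p) t = p t.
Proof. by rewrite (nth_map t) ?size_enum_ord// nth_ord_enum. Qed.

Lemma big_vertex_seqs (V : nmodType) n (F : seq nat -> V) :
  \sum_(p : {ffun 'I_n -> 'I_3}) F (path_seq p) = \sum_(s <- vertex_seqs n) F s.
Proof.
rewrite -(big_map (@path_seq n) xpredT F); apply: perm_big; apply: uniq_perm.
- rewrite map_inj_uniq ?index_enum_uniq// => p p' pp'; apply/ffunP => t.
  by apply: val_inj; rewrite /= -!nth_path_seq pp'.
- exact: vertex_seqs_uniq.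
move=> s; rewrite mem_vertex_seqs; apply/mapP/andP => [[p _ ->]|[/eqP sn s3]].
  rewrite size_map size_enum_ord eqxx; split => //.
  by apply/allP => _ /mapP[t _ ->]; exact: ltn_ord.
exists [ffun t : 'I_n => inord (nth 0%N s t) : 'I_3]; first exact: mem_index_enum.
apply: (@eq_from_nth _ 0%N); first by rewrite size_map size_enum_ord.
move=> t; rewrite sn => tn; rewrite (nth_path_seq _ (Ordinal tn)) ffunE inordK//.
by apply: (allP s3); rewrite mem_nth// sn.
Qed.

Section limit.
Variable R : realType.
Local Notation C := R[i].

(** The coefficient of a path after division by (-q)^e, for the total climb e
    that no path between the given ends can avoid. *)
Definition path_weight (w : seq 'I_2) (m : multi (size w)) (q : R) (s : seq nat) (e : nat) : R :=
  (- q) ^+ (ascent s (size w) - e) *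
  \prod_(t < size w) weight q (nth One (path_ops (map val w) s) t) (m t).

Lemma nth_path_ops (w : seq 'I_2) s (t : 'I_(size w)) :
  nth One (path_ops (map val w) s) t =
  limit_letter (tnth (in_tuple w) t) (nth 0%N s t) (nth 0%N s t.+1).
Proof.
rewrite (nth_map 0%N) ?size_iota ?size_map// nth_iota ?size_map// add0n.
by rewrite (tnth_nth (tnth (in_tuple w) t)) (nth_map (tnth (in_tuple w) t)).
Qed.

Lemma ascentE s n : ascent s n = (\sum_(t < n) (nth 0 s t.+1 - nth 0 s t))%N.
Proof. by rewrite /ascent sumnE big_map -[in iota _ _](subn0 n) big_mkord. Qed.

Lemma ascent_ge s n : (nth 0 s n - nth 0 s 0 <= ascent s n)%N.
Proof.
rewrite ascentE; elim: n => [|n IH]; first by rewrite subnn.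
rewrite big_ord_recr /=; move: (\sum_(_ < _) _)%N IH => S.
by move: (nth _ _ _) (nth _ _ n) (nth _ _ n.+1) => a b c; lia.
Qed.

Lemma path_weight_cvg (w : seq 'I_2) (m : multi (size w)) s e :
  path_weight m q s e @[q --> (0 : R)^'+] --> path_weight m 0 s e.
Proof.
apply: cvg_at_right_filter; apply: cvgM.
  pose f (q : R) := - q.
  apply: (@cvg_comp _ _ _ f (fun x : R => x ^+ _) _ (nbhs (f 0))); last exact: exprn_continuous.
  by apply: cvgN; exact: cvg_id.
by apply: cvg_big => [|t _]; [exact: mul_continuous|exact: weight_cvg].
Qed.

Lemma prodr_bool (I : finType) (P : pred I) :
  \prod_i (P i)%:R = [forall i, P i]%:R :> R.
Proof.
case: forallP => [h|h]; first by rewrite big1// => i _; rewrite h.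
case: (pickP (predC P)) => [i /= /negPf Pi|Pt].
  by rewrite (bigD1 i)//= Pi mul0r.
by case: h => i; have /negbFE := Pt i.
Qed.

Lemma path_weight0 (w : seq 'I_2) (m : multi (size w)) s e : (e <= ascent s (size w))%N ->
  path_weight m 0 s e = ((ascent s (size w) == e) && tensor_dom (path_ops (map val w) s) m)%:R.
Proof.
move=> es; rewrite /path_weight oppr0 expr0n subn_eq0 eqn_leq es andbT.
under eq_bigr do rewrite weight0.
by rewrite prodr_bool -natrM mulnb.
Qed.

Lemma expr_min (q : R) (i j : nat) : 0 < q ->
  (- q)%:C ^ Num.min (i%:Z - j%:Z) 0 = ((- q) ^- (j - i))%:C.
Proof.
move=> q0; have -> : Num.min (i%:Z - j%:Z) 0 = - (j - i)%N%:Z by lia.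
by rewrite -exprnN rmorphV ?rmorphXn// unitfE expf_neq0// oppr_eq0 gt_eqF.
Qed.

Lemma psi_qE (q : R) lam mu (w : seq 'I_2) (i j : 'I_3) (x : multi (size w) -> C) m :
  0 < q ->
  ((- q)%:C ^ Num.min (i%:Z - j%:Z) 0 *: @psi_q R q lam mu w i j x) m =
  psi_coef lam mu i *
  \sum_(s <- vertex_seqs (size w).+1 | (nth 0%N s 0 == i) && (nth 0%N s (size w) == j))
    (path_weight m q s (j - i))%:C * x (tensor_img (path_ops (map val w) s) m).
Proof.
move=> q0; rewrite expr_min// /psi_q /psi_word.
have scE (c : C) (y : multi (size w) -> C) : (c *: y) m = c * y m by [].
rewrite !scE.
rewrite mulrCA; congr (_ * _); rewrite fct_sumE mulr_sumr big_mkcond [in RHS]big_mkcond.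
pose G s := if (nth 0%N s 0 == i) && (nth 0%N s (size w) == j) then
  (path_weight m q s (j - i))%:C * x (tensor_img (path_ops (map val w) s) m) else 0.
rewrite -[RHS](big_vertex_seqs _ G) {}/G.
apply: eq_bigr => p _.
have ph : nth 0%N (path_seq p) 0 = p ord0 := nth_path_seq p ord0.
have pe : nth 0%N (path_seq p) (size w) = p ord_max := nth_path_seq p ord_max.
rewrite ph pe -!val_eqE /=; case: ifP => // /andP[/eqP p0 /eqP pl].
rewrite (tensorE (fun t x n => psi_letterE q (tnth (in_tuple w) t) _ _ x n)).
have E (t : 'I_(size w)) : limit_letter (tnth (in_tuple w) t)
    (p (widen_ord (leqnSn _) t)) (p (lift ord0 t)) = nth One (path_ops (map val w) (path_seq p)) t.
  by rewrite nth_path_ops -(nth_path_seq p (lift ord0 t)) -(nth_path_seq p (widen_ord _ t)).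
rewrite mulrA -rmorphM; congr (_ %:C * x _); last first.
  by apply/ffunP => t; rewrite !ffunE E.
rewrite /path_weight big_split/= mulrA; congr (_ * _); last by apply: eq_bigr => t _; rewrite E.
rewrite -expr_sum.
have -> : (\sum_(t < size w) (p (lift ord0 t) - p (widen_ord (leqnSn (size w)) t)))%N
    = ascent (path_seq p) (size w).
  rewrite ascentE; apply: eq_bigr => t _.
  by rewrite -(nth_path_seq p (lift ord0 t)) -(nth_path_seq p (widen_ord _ t)).
have := ascent_ge (path_seq p) (size w); rewrite ph pe p0 pl => h.
by rewrite -{1}(subnKC h) exprD mulKf// expf_neq0// oppr_eq0 gt_eqF.
Qed.

(** The limit is taken at a single vector and a single coordinate, where the
    coefficient is a finite sum of continuous functions of q. *)
Lemma psi_limit (w : seq 'I_2) (i j : 'I_3) (lam mu : C) (x : multi (size w) -> C) m :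
  normc (((- q)%:C ^ Num.min (i%:Z - j%:Z) 0 *: @psi_q R q lam mu w i j x) m
    - psi_coef lam mu i * \sum_(l <- terms (map val w) i j | tensor_dom l m) x (tensor_img l m))
     @[q --> (0 : R)^'+] --> (0 : R).
Proof.
pose P s := (nth 0%N s 0 == i) && (nth 0%N s (size w) == j).
pose X s := x (tensor_img (path_ops (map val w) s) m).
pose h q s : R := path_weight m q s (j - i).
have -> : \sum_(l <- terms (map val w) i j | tensor_dom l m) x (tensor_img l m) =
    \sum_(s <- vertex_seqs (size w).+1 | P s) (h 0 s)%:C * X s.
  rewrite /terms size_map big_map big_filter_cond big_mkcond [RHS]big_mkcond.
  apply: eq_bigr => s _; rewrite /P; case: eqP => //= s0; case: eqP => //= sn.
  rewrite /h path_weight0; last by rewrite -s0 -sn ascent_ge.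
  case: eqP => _ /=; last by rewrite mul0r.
  case: (boolP (tensor_dom _ _)) => /= [a|_]; last by rewrite andbF mul0r.
  rewrite andbT mul1r; suff -> : all nonzero_op (path_ops (map val w) s) by [].
  apply/(all_nthP One) => t; rewrite size_map size_iota size_map => tw.
  by move/forallP: a => /(_ (Ordinal tw)) /=; case: (nth _ _ _).
have H : normc (psi_coef lam mu i) * (\sum_(s <- vertex_seqs (size w).+1 | P s)
      `|h q s - h 0 s| * normc (X s)) @[q --> (0 : R)^'+] --> (0 : R).
  rewrite -[X in _ --> X](mulr0 (normc (psi_coef lam mu i))).
  apply: cvgM; first exact: cvg_cst.
  have sum0 : \sum_(s <- vertex_seqs (size w).+1 | P s) 0 * normc (X s) = 0.
    by rewrite big1// => s _; rewrite mul0r.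
  rewrite -[X in _ --> X]sum0.
  apply: cvg_big => [|s _]; first exact: add_continuous.
  apply: cvgM; last exact: cvg_cst.
  rewrite -[X in _ --> X](normr0 R); apply: cvg_norm; rewrite -[X in _ --> X](subrr (h 0 s)).
  by apply: cvgB; [exact: path_weight_cvg|exact: cvg_cst].
apply: (squeeze_cvgr _ _ H); last exact: cvg_cst.
near=> q; have q0 : 0 < q by near: q; exact: nbhs_right_gt.
rewrite normc_ge0 psi_qE// -mulrBr normcM ler_wpM2l ?normc_ge0//.
rewrite -sumrB; apply: le_trans (le_normc_sum _ _ _) _.
by apply: ler_sum => s _; rewrite -mulrBl normcM -rmorphB normc_real.
Unshelve. all: by end_near.
Qed.

(** The operator norm dominates every coordinate on the unit ball, so the norm
    limit must agree there with the coordinatewise limit; homogeneity does the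
    rest. *)
Lemma psi_terms (A : cstarType R) (z : 'I_3 -> 'I_3 -> A) lam mu w pi :
  is_psi z lam mu w pi -> forall (i j : 'I_3) (x : ell2 R (multi (size w))) m,
  pi (z i j) x m =
  psi_coef lam mu i * \sum_(l <- terms (map val w) i j | tensor_dom l m) x (tensor_img l m).
Proof.
move=> [rpi lim] i j.
have unit (x : ell2 R (multi (size w))) m : `|x| <= 1 -> pi (z i j) x m =
  psi_coef lam mu i * \sum_(l <- terms (map val w) i j | tensor_dom l m) x (tensor_img l m).
  move=> x1; set L := RHS.
  pose T q (x : ell2 R (multi (size w))) : multi (size w) -> C :=
    ((- q)%:C ^ Num.min (i%:Z - j%:Z) 0 *: @psi_q R q lam mu w i j x
                       - (pi (z i j) x : multi (size w) -> C)).
  have : (normc (T q x m))%:E @[q --> (0 : R)^'+] --> 0%E.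
    apply: (squeeze_cvge _ _ (lim i j)); last exact: cvg_cst.
    by apply: nearW => q; rewrite lee_fin normc_ge0 /=; exact: normc_le_opnorm.
  move=> /fine_cvgP[_ /= h1].
  have h2 := psi_limit i j lam mu x m.
  have h3 := cvgD h1 h2; rewrite addr0 in h3.
  have : normc (pi (z i j) x m - L) <= 0.
    have h4 : normc (T q x m) + normc (((- q)%:C ^ Num.min (i%:Z - j%:Z) 0 *:
        @psi_q R q lam mu w i j x) m - L) @[q --> (0 : R)^'+] --> (0 : R).
      exact: h3.
    have h5 : normc (pi (z i j) x m - L) @[q --> (0 : R)^'+] --> normc (pi (z i j) x m - L).
      exact: cvg_cst.
    apply: (ler_cvg_to h5 h4); apply: nearW => q.
    set b := (_ *: _) m; have TE : T q x m = b - pi (z i j) x m by [].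
    have -> : pi (z i j) x m - L = - T q x m + (b - L).
      by rewrite TE opprB addrA subrK.
    by rewrite -(normcN (T q x m)); exact: le_normcD.
  move=> h; apply/subr0_eq/eq0_normc/eqP; by rewrite eq_le h normc_ge0.
move=> x m.
(* Adding 1 to the norm avoids treating x = 0 separately. *)
pose k : C := ((ell2_norm x + 1)^-1)%:C.
have x1 : 0 < ell2_norm x + 1 by rewrite ltr_wpDl// ell2_norm_ge0.
have k0 : k != 0 by rewrite fmorph_eq0 invr_eq0 gt_eqF.
have : `|k *: x| <= 1.
  rewrite -[`|k *: x|]/((ell2_norm (k *: x))%:C) lecR ell2_normZ normc_real.
  rewrite ger0_norm ?invr_ge0 ?(ltW x1)// ler_pdivrMl// mulr1 lerDl//.
move/(unit _ m); rewrite (linear_propZ (rep_linear rpi _)).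
rewrite -[(k *: pi (z i j) x) m]/(k * pi (z i j) x m).
under eq_bigr => l _ do rewrite -[(k *: x) (tensor_img l m)]/(k * x (tensor_img l m)).
by rewrite -mulr_sumr mulrCA => /(mulfI k0).
Qed.

End limit.

(** * Links between basis vectors *)

Section links.
Variables (R : realType) (A : cstarType R) (I : choiceType).
Variables (pi : A -> ell2 R I -> ell2 R I) (rpi : is_rep pi).
Local Notation C := R[i].

(** Inside an invariant subspace, the row condition brings the coordinate m' of
    an arbitrary vector to m, and the column condition moves the basis vector m'
    to m. Both are asked of one element, so that a single search for paths
    serves the two purposes. *)
Definition linked (m m' : I) := exists (a : A) (c : C),
  [/\ c != 0, forall x, pi a x m = c * x m' & pi a (evec R m') = c *: evec R m].

Lemma linked_refl m : linked m m.
Proof.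
exists 1, 1; split => [|x|]; first exact: oner_neq0.
  by rewrite (rep1 rpi) mul1r.
by rewrite (rep1 rpi) scale1r.
Qed.

Lemma linked_trans m1 m2 m3 : linked m1 m2 -> linked m2 m3 -> linked m1 m3.
Proof.
move=> [a [c [c0 am ab]]] [b [d [d0 bm bb]]]; exists (a * b), (c * d); split.
- by rewrite mulf_neq0.
- by move=> x; rewrite (repM rpi) am bm mulrA.
- by rewrite (repM rpi) bb (linear_propZ (rep_linear rpi a)) ab scalerA mulrC.
Qed.

(** An invariant closed subspace with a vector of nonzero coordinate n contains
    the vacuum (go from m0 to n, then project), hence every basis vector. *)
Lemma irreducible_of_linked (m0 : I) (p : A) (c : C) : c != 0 ->
  (forall x, pi p x = (c * x m0) *: evec R m0) ->
  (forall m, linked m0 m /\ linked m m0) -> irreducible_rep pi.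
Proof.
move=> c0 pP linkP; split.
  move=> /seteqP[/(_ (evec R m0) Logic.I) /= /(congr1 (fun x : ell2 R _ => x m0)) /eqP].
  by rewrite evecE eqxx oner_eq0.
move=> M Mc M0 Ml Mpi.
have MZ (d : C) x : d != 0 -> M (d *: x) -> M x.
  move=> d0 Mx; have := Ml d^-1 _ _ Mx M0.
  by rewrite addr0 scalerA mulVf// scale1r.
have [M0E|[x [Mx /eqP x0]]] : M `<=` [set 0] \/ exists x, M x /\ x <> 0.
- have [|] := pselect (M `<=` [set 0]); first by left.
  move=> /existsNP[x /not_implyP[Mx xn0]]; by right; exists x.
- by left; apply/seteqP; split => // _ ->.
right; apply: closed_evec => // m.
have [n xn] : exists n, x n != 0.
  apply: contrapT => h; case/eqP: x0; apply: ell2P => n; apply/eqP.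
  by apply/negPn/negP => xn; apply: h; exists n.
have [[a [d [d0 ad _]]] _] := linkP n.
have Mm0 : M (evec R m0).
  apply: (MZ (c * (d * x n))); first by rewrite !mulf_neq0.
  by rewrite -ad -pP; exact: (Mpi _ _ (Mpi _ _ Mx)).
have [_ [b [e [e0 _ be]]]] := linkP m.
by apply: (MZ e) => //; rewrite -be; exact: Mpi.
Qed.

End links.

(** * Tensor products of partial injections *)

Section monomial.
Variables (R : realType) (A : cstarType R) (k : nat).
Variables (pi : A -> ell2 R (multi k) -> ell2 R (multi k)) (rpi : is_rep pi).
Local Notation C := R[i].

Definition acts (a : A) (c : C) (l : seq elem_op) := forall x m,
  pi a x m = if tensor_dom l m then c * x (tensor_img l m) else 0.

Lemma tensor_img_inj l (m n : multi k) :
  tensor_dom l m -> tensor_dom l n -> tensor_img l m = tensor_img l n -> m = n.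
Proof.
move=> /forallP am /forallP an /ffunP mn; apply/ffunP => t.
by apply: (op_img_inj (am t) (an t)); have := mn t; rewrite !ffunE.
Qed.

(** The column condition of a link is where injectivity enters: no other row
    reads the coordinate m'. *)
Lemma linked_acts a c l m m' : acts a c l -> c != 0 -> tensor_dom l m -> tensor_img l m = m' ->
  linked pi m m'.
Proof.
move=> al c0 lm <-; exists a, c; split => // [x|]; first by rewrite al lm.
apply: ell2P => n; rewrite al.
transitivity (c * (n == m)%:R); last by [].
rewrite evecE; case: (boolP (tensor_dom l n)) => [ln|/negPf ln].
  by congr (c * _%:R); congr nat_of_bool; apply/eqP/eqP => [/tensor_img_inj->|->].
by case: eqVneq ln => [->|_]; rewrite ?lm// mulr0.
Qed.

(** The projections 1 and P: tensor products of them are diagonal and fix the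
    vacuum. *)
Definition diag_op (o : elem_op) : bool :=
  match o with One | Vac => true | _ => false end.

Definition vacuum_op (o : elem_op) : bool := if o is Vac then true else false.

Lemma diag_op_img o n : diag_op o -> op_img o n = n.
Proof. by case: o. Qed.

Lemma diag_op_dom o n : diag_op o -> op_dom o n = (vacuum_op o ==> (n == 0%N)).
Proof. by case: o. Qed.

Definition zerom : multi k := [ffun=> 0%N].

Lemma diag_op_nth l t : all diag_op l -> diag_op (nth One l t).
Proof.
move=> /(all_nthP One) h; have [tl|tl] := ltnP t (size l); first exact: h.
by rewrite nth_default.
Qed.

Lemma tensor_img_diag_op l (m : multi k) : all diag_op l -> tensor_img l m = m.
Proof.
by move=> dl; apply/ffunP => t; rewrite ffunE diag_op_img// diag_op_nth.
Qed.

Lemma tensor_dom_zerom l : all diag_op l -> tensor_dom l zerom.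
Proof.
move=> dl; apply/forallP => t; rewrite diag_op_dom ?diag_op_nth//.
by rewrite ffunE eqxx implybT.
Qed.

Lemma acts_eigen a c l : acts a c l -> all diag_op l ->
  pi a (evec R zerom) = c *: evec R zerom.
Proof.
move=> al dl; apply: ell2P => n; rewrite al.
transitivity (c * (n == zerom)%:R); last by [].
rewrite tensor_img_diag_op// evecE; case: ifP => // /negP ln.
by case: eqVneq ln => [->|_ _]; rewrite ?tensor_dom_zerom// mulr0.
Qed.

Lemma acts_idem a c l : acts a c l -> all diag_op l ->
  forall x, pi a (pi a x) = c *: pi a x.
Proof.
move=> al dl x; apply: ell2P => n; rewrite al tensor_img_diag_op//.
transitivity (c * (pi a x n)); last by [].
by rewrite al; case: (tensor_dom l n); rewrite ?mulr0.
Qed.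

(** If every leg carries P in one of two such projections, their product
    projects onto the vacuum. *)
Lemma acts_vacuum a c l b d l' : acts a c l -> acts b d l' ->
  all diag_op l -> all diag_op l' ->
  [forall t : 'I_k, vacuum_op (nth One l t) || vacuum_op (nth One l' t)] ->
  forall x, pi (a * b) x = (c * d * x zerom) *: evec R zerom.
Proof.
move=> al bl dl dl' /forallP vac x; apply: ell2P => n.
transitivity (c * d * x zerom * (n == zerom)%:R); last by [].
rewrite (repM rpi) al bl !tensor_img_diag_op//.
case: (eqVneq n zerom) => [->|n0].
  by rewrite !tensor_dom_zerom// mulr1 mulrA.
rewrite mulr0; case: ifP => // /forallP ln; case: ifP => [/forallP ln'|]; last by rewrite mulr0.
case/eqP: n0; apply/ffunP => t; rewrite ffunE; apply/eqP.
have := ln t; have := ln' t; rewrite !diag_op_dom ?diag_op_nth//.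
by case/orP: (vac t) => -> //=.
Qed.

End monomial.

Definition raise k (m : multi k) (t : 'I_k) : multi k := upd m t (m t).+1.

(** Starting from the vacuum, build up the coordinates in order of increasing
    rank: those of larger rank are then still 0 when a coordinate is moved. *)
Lemma raise_connected k (e : multi k -> multi k -> Prop) (r : 'I_k -> nat) :
  (forall m, e m m) -> (forall m1 m2 m3, e m1 m2 -> e m2 m3 -> e m1 m3) ->
  (forall (m : multi k) t, (forall u : 'I_k, (r t < r u)%N -> m u = 0%N) ->
     e m (raise m t) /\ e (raise m t) m) ->
  forall m, e (zerom k) m /\ e m (zerom k).
Proof.
move=> eR eT eS m; have [n] := ubnP (\sum_t m t)%N; elim: n m => // n IH m mn.
have [t0 t0P|m0] := pickP (fun t : 'I_k => 0 < m t)%N; last first.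
  have -> : m = zerom k; last by [].
  by apply/ffunP => t; rewrite ffunE; apply/eqP; rewrite -leqn0 leqNgt m0.
case: (@arg_maxnP _ t0 (fun t : 'I_k => 0 < m t)%N r t0P) => t tP tmax.
pose m' : multi k := upd m t (m t).-1.
have mE : raise m' t = m.
  apply/ffunP => u; rewrite !ffunE eqxx; case: eqP => [->|//].
  by rewrite prednK.
(* Since t has maximal rank among the nonzero coordinates, it may be raised
   from m'. *)
have [|e1 e2] := eS m' t.
  move=> u tu; rewrite ffunE; case: eqP => [ut|_]; first by rewrite ut ltnn in tu.
  by apply/eqP; rewrite -leqn0 leqNgt; apply/negP => /tmax /=; rewrite leqNgt tu.
have [|e3 e4] := IH m'.
  rewrite ltnS in mn; apply: leq_trans _ mn.
  rewrite (bigD1 t)//= [X in (_ < X)%N](bigD1 t)//= ffunE eqxx.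
  rewrite -addSn prednK// leq_add2l; apply: leq_sum => u ut.
  by rewrite ffunE (negPf ut).
by rewrite mE in e1 e2; split; [apply: eT e3 e1|apply: eT e2 e4].
Qed.

(** * The six words *)

Definition word_terms (w : seq 'I_2) (i j : 'I_3) := terms (map val w) i j.

Definition row1_last (w : seq 'I_2) : 'I_3 :=
  last i1 [seq j <- [:: i1; i2; i3] | ~~ nilp (word_terms w i1 j)].

Definition row3_first (w : seq 'I_2) : 'I_3 :=
  head i3 [seq j <- [:: i1; i2; i3] | ~~ nilp (word_terms w i3 j)].

Lemma W_ind (P : seq 'I_2 -> Prop) : P [::] -> P [:: s1] -> P [:: s2] ->
  P [:: s1; s2] -> P [:: s2; s1] -> P [:: s1; s2; s1] -> forall w, w \in W -> P w.
Proof.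
by move=> ? ? ? ? ? ? w; rewrite !inE => /or4P[|||/or3P[]] /eqP->.
Qed.

(** For id, s1, s2, s1s2, s2s1, s1s2s1 the tensor product l1 in the first row is
    1, P, 1, P(x)P, 1(x)P, P(x)P(x)1 and l3 in the third row is
    1, 1, P, 1(x)P, P(x)P, 1(x)P(x)P. *)
Lemma corner_spec w : w \in W -> exists l1 l3,
  [/\ word_terms w i1 (row1_last w) = [:: l1], word_terms w i3 (row3_first w) = [:: l3],
      all diag_op l1, all diag_op l3 &
      [forall t : 'I_(size w), vacuum_op (nth One l1 t) || vacuum_op (nth One l3 t)]].
Proof.
move: w; apply: W_ind; do 2 eexists; (split; [by vm_compute|by vm_compute|by []|by []|
   by apply/forallP => -[[|[|[|//]]] ?]]).
Qed.

Lemma row1_lastP w (j : 'I_3) : w \in W -> (row1_last w < j)%N -> word_terms w i1 j = [::].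
Proof.
by move: w; apply: W_ind; case: j => [[|[|[|//]]] ?]; vm_compute.
Qed.

Lemma row3_firstP w (j : 'I_3) : w \in W -> (j < row3_first w)%N -> word_terms w i3 j = [::].
Proof.
by move: w; apply: W_ind; case: j => [[|[|[|//]]] ?]; vm_compute.
Qed.

(** The pairs of columns are (1,3), (2,3), (1,2), (3,2), (2,1), (3,1). *)
Lemma corners_inj w w' : w \in W -> w' \in W ->
  row1_last w = row1_last w' -> row3_first w = row3_first w' -> w = w'.
Proof.
move=> wW w'W e1 e3; apply/eqP; move: (congr1 val e1) (congr1 val e3) => {e1 e3}.
by move: w wW w' w'W; do 2 apply: W_ind; vm_compute.
Qed.

Section words.
Variables (R : realType) (A : cstarType R) (z : 'I_3 -> 'I_3 -> A).
Variables (lam mu : R[i]) (lam1 : `|lam| = 1) (mu1 : `|mu| = 1).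
Local Notation C := R[i].

Lemma psi_coef_neq0 i : psi_coef lam mu i != 0.
Proof.
have nz (c : C) : `|c| = 1 -> c != 0 by move=> c1; rewrite -normr_eq0 c1 oner_eq0.
have nzc (c : C) : `|c| = 1 -> c^* != 0 by move=> c1; rewrite fmorph_eq0 nz.
case: i => [[|[|[|//]]] ?]; rewrite /psi_coef /=;
  [exact: nz|apply: mulf_neq0; [exact: nzc|exact: nz]|exact: nzc].
Qed.

Lemma acts_terms w pi i j l : is_psi z lam mu w pi ->
  word_terms w i j = [:: l] -> acts pi (z i j) (psi_coef lam mu i) l.
Proof.
move=> ppi wij x m; rewrite (psi_terms ppi) -[terms _ _ _]/(word_terms w i j) wij.
by rewrite big_mkcond big_seq1; case: ifP => // _; rewrite mulr0.
Qed.

Lemma terms_nil w pi i j : is_psi z lam mu w pi ->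
  word_terms w i j = [::] -> forall x, pi (z i j) x = 0.
Proof.
move=> ppi wij x; apply: ell2P => m.
by rewrite (psi_terms ppi) -[terms _ _ _]/(word_terms w i j) wij big_nil mulr0.
Qed.

Lemma linked_terms w pi i j l m m' : is_psi z lam mu w pi ->
  word_terms w i j = [:: l] -> tensor_dom l m -> tensor_img l m = m' -> linked pi m m'.
Proof.
move=> ppi wij; exact: linked_acts (acts_terms ppi wij) (psi_coef_neq0 i).
Qed.

End words.

(** * Links supplied by the generators *)

Section irreducible.
Variables (R : realType) (A : cstarType R) (z : 'I_3 -> 'I_3 -> A).
Variables (lam mu : R[i]) (lam1 : `|lam| = 1) (mu1 : `|mu| = 1).
Local Notation C := R[i].

(* Normalising the proofs of the bounds makes equal ordinals syntactically
   equal. *)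
Ltac ord_cases := let h := fresh in
  case=> [[|[|[|//]]] h] //; rewrite (bool_irrelevance h isT) {h}.

Ltac terms_apply := apply/forallP; ord_cases; rewrite /= ?ffunE //=;
  try match goal with h : forall u, _ -> _ = 0%N |- _ => by rewrite h end.

Ltac step ppi i j :=
  refine (linked_terms (i := i) (j := j) lam1 mu1 ppi _ _ _);
  [ vm_compute; reflexivity
  | by terms_apply
  | by apply/ffunP; ord_cases; rewrite /= !ffunE /=].

(* One link along the only term of z_(i,j), then the rest of the journey. *)
Ltac step_then ppi i j :=
  eapply linked_trans;
  [ exact: ppi.1
  | refine (linked_terms (i := i) (j := j) lam1 mu1 ppi _ _ erefl);
    [ vm_compute; reflexivity | by terms_apply]
  | ].

(** A link along S raises a coordinate and one along S^* lowers it. For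
    one or two letters the products of z_(1,1), z_(2,2), z_(3,3) contain S and
    S^* on each leg separately. For s1s2s1 one has z_(1,1) = S(x)1(x)S,
    z_(2,2) = S^*(x)S(x)S^* and z_(3,3) = 1(x)S^*(x)1, which move the middle
    leg alone; the outer legs are separated by z_(2,3) = S^*(x)P(x)1 and
    z_(3,2) = 1(x)P(x)S^*, which require the middle coordinate to be 0: each of
    them lowers one outer coordinate, and after a step along z_(1,1) it leaves
    only the other one raised. Hence the middle leg has the larger rank. *)
Lemma psi_connected w : w \in W -> forall pi, is_psi z lam mu w pi ->
  forall m, linked pi (zerom _) m /\ linked pi m (zerom _).
Proof.
move: w; apply: W_ind => pi ppi;
  apply: (raise_connected (r := fun t => (t == 1%N :> nat)));
  try exact: (linked_refl ppi.1); try exact: (linked_trans ppi.1); move=> m.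
- by case.
- by ord_cases => _; split; [step ppi i1 i1|step ppi i2 i2].
- by ord_cases => _; split; [step ppi i2 i2|step ppi i3 i3].
- ord_cases => _; split.
  + step ppi i1 i1.
  + step_then ppi i2 i2; step ppi i3 i3.
  + step_then ppi i1 i1; step ppi i2 i2.
  + step ppi i3 i3.
- ord_cases => _; split.
  + step_then ppi i1 i1; step ppi i2 i2.
  + step ppi i3 i3.
  + step ppi i1 i1.
  + step_then ppi i2 i2; step ppi i3 i3.
(* The word s1s2s1, coordinate by coordinate; hm says that the middle one is 0
   while an outer one is moved. *)
ord_cases => hm; split.
- step_then ppi i1 i1; step ppi i3 i2.
- step ppi i2 i3.
- step_then ppi i1 i1; step ppi i2 i2.
- step ppi i3 i3.
- step_then ppi i1 i1; step ppi i2 i3.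
- step ppi i3 i2.
Qed.
End irreducible.

(** * Eigenvalues as invariants *)

Section eigen.
Variables (R : realType) (A : cstarType R).

Definition has_eigenvalue (I : choiceType) (pi : A -> ell2 R I -> ell2 R I)
    (a : A) (c : R[i]) := exists2 x, x != 0 & pi a x = c *: x.

Lemma equivalent_eigenvalue (I J : choiceType) (pi : A -> ell2 R I -> ell2 R I)
    (rho : A -> ell2 R J -> ell2 R J) a c :
  equivalent_reps pi rho -> has_eigenvalue pi a c <-> has_eigenvalue rho a c.
Proof.
move=> [U [linU [V VK UK] _ UE]]; have U0 := linear_prop0 linU.
have UZ := linear_propZ linU; split=> [[x x0 xE]|[y y0 yE]].
  exists (U x); last by rewrite -UE xE UZ.
  by apply: contra_neq x0 => /(congr1 V); rewrite -U0 !VK.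
exists (V y); last by apply: (can_inj VK); rewrite UE UZ UK.
by apply: contra_neq y0 => /(congr1 U); rewrite UK U0.
Qed.

Lemma eigenvalue_idem (I : choiceType) (pi : A -> ell2 R I -> ell2 R I) a c d :
  linear (pi a) -> (forall x, pi a (pi a x) = c *: pi a x) -> d != 0 ->
  has_eigenvalue pi a d -> d = c.
Proof.
move=> la idem d0 [x x0 xE]; have := idem x.
rewrite xE (linear_propZ la) xE !scalerA => /eqP.
rewrite -subr_eq0 -scalerBl scaler_eq0 (negPf x0) orbF subr_eq0 => /eqP.
exact: mulIf.
Qed.

Lemma eigenvalue_zero (I : choiceType) (pi : A -> ell2 R I -> ell2 R I) a c :
  (forall x, pi a x = 0) -> has_eigenvalue pi a c -> c = 0.
Proof.
move=> a0 [x x0]; rewrite a0 => /esym/eqP; rewrite scaler_eq0 (negPf x0) orbF.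
by move/eqP.
Qed.

Variable z : 'I_3 -> 'I_3 -> A.

Lemma corner_eigenvalue lam mu w pi i j l :
  is_psi z lam mu w pi -> word_terms w i j = [:: l] -> all diag_op l ->
  has_eigenvalue pi (z i j) (psi_coef lam mu i) /\
  forall x, pi (z i j) (pi (z i j) x) = psi_coef lam mu i *: pi (z i j) x.
Proof.
move=> ppi wij dl; have al := acts_terms ppi wij; split.
  by exists (evec R (zerom _)); [exact: evec_neq0|exact: acts_eigen al dl].
exact: acts_idem al dl.
Qed.

End eigen.

Theorem theorem3p1p1 (R : realType) (A : cstarType R) (z : 'I_3 -> 'I_3 -> A)
    (univ : is_A20 z) :
  (forall (lam mu : R[i]) (w : seq 'I_2)
      (pi : A -> ell2 R (multi (size w)) -> ell2 R (multi (size w))),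
    `|lam| = 1 -> `|mu| = 1 -> w \in W ->
    is_psi z lam mu w pi -> irreducible_rep pi) /\
  (forall (lam mu lam' mu' : R[i]) (w w' : seq 'I_2)
      (pi : A -> ell2 R (multi (size w)) -> ell2 R (multi (size w)))
      (pi' : A -> ell2 R (multi (size w')) -> ell2 R (multi (size w'))),
    `|lam| = 1 -> `|mu| = 1 -> `|lam'| = 1 -> `|mu'| = 1 ->
    w \in W -> w' \in W ->
    (lam, mu, w) <> (lam', mu', w') ->
    is_psi z lam mu w pi -> is_psi z lam' mu' w' pi' ->
    ~ equivalent_reps pi pi').
Proof.
split=> [lam mu w pi lam1 mu1 wW ppi|].
  have [l1 [l3 [e1 e3 d1 d3 vac]]] := corner_spec wW.
  have pP := acts_vacuum ppi.1 (acts_terms ppi e1) (acts_terms ppi e3) d1 d3 vac.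
  apply: (irreducible_of_linked _ pP); last exact: (psi_connected lam1 mu1 wW ppi).
  by rewrite mulf_neq0// psi_coef_neq0.
move=> lam mu lam' mu' w w' pi pi' lam1 mu1 lam1' mu1' wW w'W neq ppi ppi' eqv.
have [l1 [l3 [e1 e3 d1 d3 _]]] := corner_spec wW.
have [l1' [l3' [e1' e3' d1' d3' _]]] := corner_spec w'W.
have [v1 p1] := corner_eigenvalue ppi e1 d1.
have [v3 p3] := corner_eigenvalue ppi e3 d3.
have [v1' _] := corner_eigenvalue ppi' e1' d1'.
have [v3' _] := corner_eigenvalue ppi' e3' d3'.
have nz i := psi_coef_neq0 lam1 mu1 i.
have nz' i := psi_coef_neq0 lam1' mu1' i.
move: v1' v3' v1 v3.
rewrite -!(equivalent_eigenvalue _ _ eqv) => v1' v3'.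
rewrite !(equivalent_eigenvalue _ _ eqv) => v1 v3.
(* A column beyond the extreme one of either word carries the zero operator,
   which has no nonzero eigenvalue. *)
have ww' : w = w'.
  apply: corners_inj => //; apply/val_inj/eqP; rewrite eqn_leq; apply/andP; split.
  - rewrite leqNgt; apply/negP => lt.
    by have /eqP := eigenvalue_zero (terms_nil ppi' (row1_lastP w'W lt)) v1; rewrite (negPf (nz _)).
  - rewrite leqNgt; apply/negP => lt.
    by have /eqP := eigenvalue_zero (terms_nil ppi (row1_lastP wW lt)) v1'; rewrite (negPf (nz' _)).
  - rewrite leqNgt; apply/negP => lt.
    by have /eqP := eigenvalue_zero (terms_nil ppi (row3_firstP wW lt)) v3'; rewrite (negPf (nz' _)).
  - rewrite leqNgt; apply/negP => lt.
    by have /eqP := eigenvalue_zero (terms_nil ppi' (row3_firstP w'W lt)) v3; rewrite (negPf (nz _)).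
apply: neq; rewrite -ww' in v1' v3'.
have E1 := eigenvalue_idem (rep_linear ppi.1 _) p1 (nz' _) v1'.
have E3 := eigenvalue_idem (rep_linear ppi.1 _) p3 (nz' _) v3'.
rewrite /psi_coef /= in E1 E3.
by rewrite ww' E1 (can_inj (@conjcK R) E3).
Qed.
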